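(* Let $A$ be an annihilator $\sigma$-$C^{\ast}$-algebra. Then $A$ is topologically ${}^{\ast}$-isomorphic to the Cartesian product (with product topology) of a countable family of annihilator $C^{\ast}$-algebras.
   Context: A locally $C^{\ast}$-algebra is a complete Hausdorff locally convex ${}^{\ast}$-algebra over $\mathbb{C}$ with jointly continuous multiplication whose topology is given by a family of $C^{\ast}$-seminorms; a $\sigma$-$C^{\ast}$-algebra is a metrizable locally $C^{\ast}$-algebra. A topological algebra $A$ is an annihilator algebra if for every closed left ideal $J$ and closed right ideal $K$: $\mathrm{ran}(J)=0\iff J=A$ and $\mathrm{lan}(K)=0\iff K=A$, where $\mathrm{lan}(S)=\{a:aS=0\}$, $\mathrm{ran}(S)=\{a:Sa=0\}$. *)

(* Defs.v *)
From Stdlib Require List.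
From HB Require Import structures.
From mathcomp Require Import all_boot all_order all_algebra.
From mathcomp Require Import reals.
From mathcomp Require Import complex.
Set Implicit Arguments. Unset Strict Implicit. Unset Printing Implicit Defensive.
Import Order.TTheory GRing.Theory Num.Theory.
Local Open Scope ring_scope.

Section LocCstar.
Variable R : realType.
Local Notation C := R[i].

Definition cabs (z : C) : R := Normc.normc z.

Section Alg.
Variables (A : lmodType C) (mul : A -> A -> A) (star : A -> A).

Definition is_star_algebra : Prop :=
  (forall x y z, mul x (mul y z) = mul (mul x y) z) /\
  (forall x y z, mul (x + y) z = mul x z + mul y z) /\
  (forall x y z, mul x (y + z) = mul x y + mul x z) /\
  (forall (a : C) x y, mul (a *: x) y = a *: mul x y) /\
  (forall (a : C) x y, mul x (a *: y) = a *: mul x y) /\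
  (forall x y, star (x + y) = star x + star y) /\
  (forall (a : C) x, star (a *: x) = conjc a *: star x) /\
  (forall x, star (star x) = x) /\
  (forall x y, star (mul x y) = mul (star y) (star x)).

Definition is_Cstar_seminorm (p : A -> R) : Prop :=
  [/\ (forall x y, p (x + y) <= p x + p y),
      (forall (a : C) x, p (a *: x) = cabs a * p x),
      (forall x y, p (mul x y) <= p x * p y) &
      (forall x, p (mul (star x) x) = p x ^+ 2)].

Section Topology.
Variables (J : Type) (p : J -> A -> R).

Definition sn_open (U : A -> Prop) : Prop :=
  forall x, U x -> exists (F : seq J) (e : R), 0 < e /\
    (forall y, (forall j, List.In j F -> p j (y - x) < e) -> U y).

Definition sn_closed (U : A -> Prop) : Prop := sn_open (fun x => ~ U x).

Definition sn_hausdorff : Prop :=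
  forall x, (forall j, p j x = 0) -> x = 0.

Definition is_proper_filter (F : (A -> Prop) -> Prop) : Prop :=
  [/\ F (fun _ => True),
      (forall U V, F U -> F V -> F (fun x => U x /\ V x)),
      (forall U V : A -> Prop, (forall x, U x -> V x) -> F U -> F V) &
      ~ F (fun _ => False)].

Definition sn_cauchy (F : (A -> Prop) -> Prop) : Prop :=
  forall j (e : R), 0 < e -> exists S, F S /\
    (forall x y, S x -> S y -> p j (x - y) < e).

Definition sn_converges (F : (A -> Prop) -> Prop) (a : A) : Prop :=
  forall j (e : R), 0 < e -> F (fun y => p j (y - a) < e).

Definition sn_complete : Prop :=
  forall F, is_proper_filter F -> sn_cauchy F -> exists a, sn_converges F a.

Definition is_locally_Cstar : Prop :=
  [/\ is_star_algebra, (forall j, is_Cstar_seminorm (p j)),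
      sn_hausdorff & sn_complete].

Definition is_metric (d : A -> A -> R) : Prop :=
  [/\ (forall x y, d x y = 0 <-> x = y),
      (forall x y, d x y = d y x) &
      (forall x y z, d x z <= d x y + d y z)].

Definition metrizable : Prop :=
  exists d, is_metric d /\
    forall U : A -> Prop, sn_open U <->
      (forall x, U x -> exists e : R, 0 < e /\ forall y, d x y < e -> U y).

Definition is_sigma_Cstar : Prop := is_locally_Cstar /\ metrizable.

Definition is_subspace (S : A -> Prop) : Prop :=
  [/\ S 0, (forall x y, S x -> S y -> S (x + y)) &
      (forall (a : C) x, S x -> S (a *: x))].

Definition is_left_ideal (S : A -> Prop) : Prop :=
  is_subspace S /\ forall a x, S x -> S (mul a x).

Definition is_right_ideal (S : A -> Prop) : Prop :=
  is_subspace S /\ forall a x, S x -> S (mul x a).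

Definition lan (S : A -> Prop) : A -> Prop := fun a => forall s, S s -> mul a s = 0.
Definition ran (S : A -> Prop) : A -> Prop := fun a => forall s, S s -> mul s a = 0.

Definition is_zero_set (S : A -> Prop) : Prop := forall x, S x <-> x = 0.
Definition is_whole (S : A -> Prop) : Prop := forall x, S x.

Definition annihilator_algebra : Prop :=
  (forall K, is_left_ideal K -> sn_closed K -> (is_zero_set (ran K) <-> is_whole K)) /\
  (forall K, is_right_ideal K -> sn_closed K -> (is_zero_set (lan K) <-> is_whole K)).

End Topology.
End Alg.

(* A C*-algebra: a locally C*-algebra whose topology is given by one (C*-)norm;
   (Hausdorff + a single seminorm = norm, complete = Banach). *)
Record Cstar_algebra := CstarAlg {
  cs_car : lmodType C;
  cs_mul : cs_car -> cs_car -> cs_car;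
  cs_star : cs_car -> cs_car;
  cs_norm : cs_car -> R;
  cs_ax : is_locally_Cstar cs_mul cs_star (fun _ : unit => cs_norm)
}.

Definition cs_open (B : Cstar_algebra) (U : cs_car B -> Prop) : Prop :=
  sn_open (fun _ : unit => @cs_norm B) U.

Definition cs_annihilator (B : Cstar_algebra) : Prop :=
  annihilator_algebra (@cs_mul B) (fun _ : unit => @cs_norm B).

Section Product.
Variables (I : Type) (B : I -> Cstar_algebra).
Definition prodB := forall i, cs_car (B i).

Definition prod_open (U : prodB -> Prop) : Prop :=
  forall x, U x -> exists (F : seq I) (V : forall i, cs_car (B i) -> Prop),
    (forall i, List.In i F -> cs_open (V i) /\ V i (x i)) /\
    (forall y, (forall i, List.In i F -> V i (y i)) -> U y).
End Product.

Definition countable_type (I : Type) : Prop :=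
  exists f : I -> nat, injective f.

Definition top_star_iso (A : lmodType C) (mul : A -> A -> A) (star : A -> A)
  (J : Type) (p : J -> A -> R) (I : Type) (B : I -> Cstar_algebra)
  (phi : A -> prodB B) : Prop :=
  (forall x y i, phi (x + y) i = phi x i + phi y i) /\
  (forall (a : C) x i, phi (a *: x) i = a *: phi x i) /\
  (forall x y i, phi (mul x y) i = @cs_mul (B i) (phi x i) (phi y i)) /\
  (forall x i, phi (star x) i = @cs_star (B i) (phi x i)) /\
  bijective phi /\
  (forall U, prod_open U -> sn_open p (fun x => U (phi x))) /\
  (forall V, sn_open p V -> prod_open (fun y => exists x, V x /\ phi x = y)).

End LocCstar.

(* Main.v *)
(** Let [q_n] be the maximum of the first [n] seminorms of a defining sequence
    and [N_n = ker q_n].  A closed *-ideal [S] is a topological direct summand: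
    [S + ran S] is closed, because orthogonality gives [p s <= p (s + t)] for
    every C*-seminorm [p], and its right annihilator vanishes.  On [ran N_n]
    every seminorm is dominated by [q_n]: for [h] self-adjoint there with
    [q_n h < 1], the left ideal of all [x - x h^2] has zero right annihilator,
    so it is dense, whereas [h^2] would have no approximate left quasi-inverse
    for a C*-seminorm equal to [1] at [h].  Hence the closed ideals
    [B_n = ran N_(n+1) `&` N_n] are C*-algebras for [q_(n+1)], and
    [x |-> (x_n)_n], with [x_n] the component of [x] in [B_n], is the
    isomorphism: [x - (x_0 + ... + x_(n-1))] lies in [N_n]. *)
From Stdlib Require List.
Require Import Defs.
From HB Require Import structures.
From mathcomp Require Import all_boot all_order all_algebra.
From mathcomp Require Import reals complex.
From mathcomp Require Import boolp zify ring lra.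
Set Implicit Arguments. Unset Strict Implicit. Unset Printing Implicit Defensive.
Import Order.TTheory GRing.Theory Num.Theory.
Local Open Scope ring_scope.

(** * Identities in a *-algebra without unit *)

Section StarAlgebra.
Variables (R : realType) (A : lmodType R[i]).
Variables (mul : A -> A -> A) (star : A -> A).
Hypothesis star_alg : is_star_algebra mul star.
Local Notation "x ** y" := (mul x y) (at level 40, left associativity).

Lemma sa_mulA x y z : x ** (y ** z) = x ** y ** z.
Proof. by move: star_alg => [-> _]. Qed.

Lemma sa_mulDl x y z : (x + y) ** z = x ** z + y ** z.
Proof. by move: star_alg => [_ [-> _]]. Qed.

Lemma sa_mulDr x y z : x ** (y + z) = x ** y + x ** z.
Proof. by move: star_alg => [_ [_ [-> _]]]. Qed.

Lemma sa_mulZl a x y : (a *: x) ** y = a *: (x ** y).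
Proof. by move: star_alg => [_ [_ [_ [-> _]]]]. Qed.

Lemma sa_mulZr a x y : x ** (a *: y) = a *: (x ** y).
Proof. by move: star_alg => [_ [_ [_ [_ [-> _]]]]]. Qed.

Lemma sa_starD x y : star (x + y) = star x + star y.
Proof. by move: star_alg => [_ [_ [_ [_ [_ [-> _]]]]]]. Qed.

Lemma sa_starZ a x : star (a *: x) = conjc a *: star x.
Proof. by move: star_alg => [_ [_ [_ [_ [_ [_ [-> _]]]]]]]. Qed.

Lemma sa_starK x : star (star x) = x.
Proof. by move: star_alg => [_ [_ [_ [_ [_ [_ [_ [-> _]]]]]]]]. Qed.

Lemma sa_starM x y : star (x ** y) = star y ** star x.
Proof. by move: star_alg => [_ [_ [_ [_ [_ [_ [_ [_ ->]]]]]]]]. Qed.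

Lemma sa_mul0l x : 0 ** x = 0.
Proof. by rewrite -(scale0r 0) sa_mulZl !scale0r. Qed.

Lemma sa_mul0r x : x ** 0 = 0.
Proof. by rewrite -(scale0r 0) sa_mulZr !scale0r. Qed.

Lemma sa_mulNl x y : (- x) ** y = - (x ** y).
Proof. by rewrite -scaleN1r sa_mulZl scaleN1r. Qed.

Lemma sa_mulNr x y : x ** (- y) = - (x ** y).
Proof. by rewrite -scaleN1r sa_mulZr scaleN1r. Qed.

Lemma sa_mulBl x y z : (x - y) ** z = x ** z - y ** z.
Proof. by rewrite sa_mulDl sa_mulNl. Qed.

Lemma sa_mulBr x y z : x ** (y - z) = x ** y - x ** z.
Proof. by rewrite sa_mulDr sa_mulNr. Qed.

Lemma sa_star0 : star 0 = 0.
Proof. by rewrite -(scale0r 0) sa_starZ conjc0 !scale0r. Qed.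

Lemma sa_starN x : star (- x) = - star x.
Proof. by rewrite -scaleN1r sa_starZ rmorphN rmorph1 scaleN1r. Qed.

Lemma sa_starB x y : star (x - y) = star x - star y.
Proof. by rewrite sa_starD sa_starN. Qed.

(** Reversing the product exchanges left and right ideals, so results proved for left ideals can be
    reused for right ideals. *)
Lemma star_algebra_op : is_star_algebra (fun x y => mul y x) star.
Proof.
do !split => *; [exact/esym/sa_mulA|exact: sa_mulDr|exact: sa_mulDl|
  exact: sa_mulZr|exact: sa_mulZl|exact: sa_starD|exact: sa_starZ|
  exact: sa_starK|exact: sa_starM].
Qed.

(** * C*-seminorms *)

Section Seminorm.
Variable p : A -> R.
Hypothesis Cp : is_Cstar_seminorm mul star p.

Lemma snD x y : p (x + y) <= p x + p y.
Proof. by case: Cp. Qed.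

Lemma snZ a x : p (a *: x) = cabs a * p x.
Proof. by case: Cp. Qed.

Lemma snM x y : p (x ** y) <= p x * p y.
Proof. by case: Cp. Qed.

Lemma sn_star_mul x : p (star x ** x) = p x ^+ 2.
Proof. by case: Cp. Qed.

Lemma sn0 : p 0 = 0.
Proof. by rewrite -(scale0r 0) snZ /cabs ComplexField.Normc.normc0 mul0r. Qed.

Lemma snN x : p (- x) = p x.
Proof.
by rewrite -scaleN1r snZ /cabs normcN ComplexField.Normc.normc1 mul1r.
Qed.

Lemma snB x y : p (x - y) <= p x + p y.
Proof. by rewrite -(snN y) snD. Qed.

Lemma sn_distC x y : p (x - y) = p (y - x).
Proof. by rewrite -snN opprB. Qed.

Lemma sn_ge0 x : 0 <= p x.
Proof. by have := snB x x; rewrite subrr sn0; lra. Qed.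

Lemma snZr (t : R) x : 0 <= t -> p (t%:C%C *: x) = t * p x.
Proof.
by move=> t0; rewrite snZ /cabs /= expr0n addr0 sqrtr_sqr ger0_norm.
Qed.

Lemma sn_star_le x : p x <= p (star x).
Proof.
have := snM (star x) x; rewrite sn_star_mul.
by have := sn_ge0 x; have := sn_ge0 (star x); nra.
Qed.

Lemma sn_star x : p (star x) = p x.
Proof.
by apply/eqP; rewrite eq_le sn_star_le -{2}(sa_starK x) sn_star_le.
Qed.

Lemma sn_sqr h : star h = h -> p (h ** h) = p h ^+ 2.
Proof. by move=> sh; rewrite -sn_star_mul sh. Qed.

Lemma Cstar_seminorm_op : is_Cstar_seminorm (fun x y => mul y x) star p.
Proof.
split=> [x y|a x|x y|x]; [exact: snD|exact: snZ|by rewrite mulrC snM|].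
by rewrite -(sn_star x) -sn_star_mul sa_starK.
Qed.

(** Multiplying [x + y] by [star x] leaves [star x ** x], of seminorm [p x ^+ 2]; one factor [p x]
    then cancels. *)
Lemma sn_orthogonal x y : star x ** y = 0 -> p x <= p (x + y).
Proof.
move=> xy0; have := snM (star x) (x + y).
rewrite sa_mulDr xy0 addr0 sn_star_mul sn_star.
by have := sn_ge0 x; have := sn_ge0 (x + y); nra.
Qed.

(* [x^2 + y^2 = w^* w] for [w = x + i y], and [2 x = w + w^*]. *)
Lemma sn_sum_squares x y : star x = x -> star y = y -> x ** y = y ** x ->
  p x ^+ 2 <= p (x ** x + y ** y).
Proof.
move=> sx sy xy.
set w := x + 'i%C *: y.
have sw : star w = x - 'i%C *: y.
  rewrite sa_starD sx sa_starZ sy -scaleNr; congr (_ + _ *: _).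
  by apply/eqP; rewrite eq_complex /= oppr0 !eqxx.
have ii : 'i%C * 'i%C = -1 :> R[i].
  by apply/eqP; rewrite eq_complex /=; apply/andP; split; apply/eqP; ring.
have -> : x ** x + y ** y = star w ** w.
  rewrite sw sa_mulBl !sa_mulDr !sa_mulZl !sa_mulZr scalerA ii scaleN1r xy.
  by rewrite opprD opprK addrA addrK.
have x2 : x + x = w + star w.
  by rewrite sw addrACA subrr addr0.
have := snD w (star w); rewrite -x2 sn_star_mul sn_star -mulr2n -scaler_nat.
have -> : 2%:R = (2 : R)%:C%C :> R[i] by rewrite rmorph_nat.
rewrite snZr //.
by have := sn_ge0 x; have := sn_ge0 w; nra.
Qed.

(** * Geometric sums in a self-adjoint element of seminorm one *)

Section Approx.
Variable h : A.
Hypotheses (star_h : star h = h) (p_h : p h = 1).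

(** For lack of a unit the exponent is shifted: [pw n] is [h ^ (n + 1)]. *)
Fixpoint pw n := if n is m.+1 then h ** pw m else h.

Lemma pwM m n : pw m ** pw n = pw (m + n).+1.
Proof. by elim: m => [//|m IH]; rewrite addSn /= -sa_mulA IH. Qed.

Lemma star_pw n : star (pw n) = pw n.
Proof.
elim: n => [//|n IH] /=; rewrite sa_starM IH star_h.
by rewrite -[h]/(pw 0) !pwM addn0.
Qed.

Lemma p_pw n : p (pw n) = 1.
Proof.
have le1 m : p (pw m) <= 1.
  elim: m => [|m IH] /=; first by rewrite p_h.
  by apply: le_trans (snM _ _) _; rewrite p_h mul1r.
elim: n => [//|n IH]; apply/eqP; rewrite eq_le le1 /=.
have sq : p (pw (n + n).+1) = 1 by rewrite -pwM sn_sqr ?star_pw // IH expr1n.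
(* The square of a power of seminorm [1] has seminorm [1], and it is the next power, possibly times
   a factor of seminorm at most [1]. *)
case: n IH sq => [_ <- //|n IH sq].
have -> : 1 = p (pw n.+2 ** pw n) by rewrite pwM -sq addnS.
by apply: le_trans (snM _ _) _; have := le1 n; have := sn_ge0 (pw n.+2); nra.
Qed.

(* [geo N j] is the sum of [h ^ (2 k + j + 1)] over [k < 2 ^ N]. *)
Fixpoint geo N j :=
  if N is N'.+1 then geo N' j + geo N' (j + 2 ^ N)%N else pw j.

Lemma star_geo N j : star (geo N j) = geo N j.
Proof.
by elim: N j => [|N IH] j /=; rewrite ?star_pw // sa_starD !IH.
Qed.

Lemma geo_pw N j m : geo N j ** pw m = geo N (j + m)%N.+1.
Proof.
elim: N j => [|N IH] j; first exact: pwM.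
by rewrite [LHS]sa_mulDl !IH /= addSn addnAC.
Qed.

(** Moving exponents between the factors yields both the commutations and [a ** c = b ** b] in the
    doubling step. *)
Lemma geoM N M j k j' k' : (j + k = j' + k')%N ->
  geo N j ** geo M k = geo N j' ** geo M k'.
Proof.
elim: M k k' => [|M IH] k k' e; first by rewrite !geo_pw e.
by rewrite /= !sa_mulDr (IH _ _ e) (IH _ (k' + 2 ^ M.+1)%N) // !addnA e.
Qed.

Lemma h_geo N j : h ** geo N j = geo N j.+1.
Proof.
by elim: N j => [//|N IH] j; rewrite [LHS]sa_mulDr !IH.
Qed.

(** Since [geo N j.+2] is [h^2] times [geo N j], this is a telescoping geometric series in [h^2];
    its boundary terms stay bounded while the sum itself grows with [N]. *)
Lemma geo_telescope N j : geo N j - geo N j.+2 = pw j - pw (j + 2 ^ N.+1)%N.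
Proof.
elim: N j => [|N IH] j; first by rewrite addn2.
rewrite /= opprD addrACA IH !addSn IH addrA subrK -addnA.
by rewrite addnn -mul2n -expnS.
Qed.

(* [(1 + e^2)^2 = (2 e)^2 + (1 - e^2)^2] with [e = h ^ (2 ^ N)]: adding the
   next [2 ^ N] terms at least doubles the seminorm. *)
Lemma geo_double N j : 2 * p (geo N (j + 2 ^ N)%N) <= p (geo N.+1 j).
Proof.
set d := (2 ^ N)%N.
set a := geo N j; set b := geo N (j + d)%N; set c := geo N (j + 2 ^ N.+1)%N.
have dd : (2 ^ N.+1 = d + d)%N by rewrite expnS mul2n addnn.
have ac : a ** c = b ** b by apply: geoM; rewrite dd; lia.
have ca : c ** a = b ** b by apply: geoM; rewrite dd; lia.
have ba : b ** a = a ** b by apply: geoM; lia.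
have bc : b ** c = c ** b by apply: geoM; lia.
have sq : (a + c) ** (a + c) =
    (b + b) ** (b + b) + (a - c) ** (a - c).
  rewrite !(sa_mulDl, sa_mulDr, sa_mulNl, sa_mulNr) ac ca opprK.
  set x := b ** b; set y := a ** a; set z := c ** c.
  rewrite [RHS]addrCA -!addrA; congr (y + _).
  by rewrite addKr [x + (- x + z)]addrA subrr add0r.
have comm : (b + b) ** (a - c) = (a - c) ** (b + b).
  by rewrite !(sa_mulDl, sa_mulDr, sa_mulNl, sa_mulNr) ba bc addrACA.
have star_bb : star (b + b) = b + b by rewrite sa_starD !star_geo.
have star_ac : star (a - c) = a - c by rewrite sa_starB !star_geo.
have star_s : star (a + c) = a + c by rewrite sa_starD !star_geo.
have := sn_sum_squares star_bb star_ac comm.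
rewrite -sq sn_sqr //= -/a -/c.
rewrite -mulr2n -scaler_nat.
have -> : 2%:R = (2 : R)%:C%C :> R[i] by rewrite rmorph_nat.
rewrite snZr //.
by have := sn_ge0 b; have := sn_ge0 (a + c); nra.
Qed.

Lemma p_geo N j : 2 ^+ N <= p (geo N j).
Proof.
elim: N j => [|N IH] j; first by rewrite p_pw.
apply: le_trans (geo_double N j).
by rewrite exprS ler_wpM2l.
Qed.

(* In the unitization: [1 - h^2] has no left inverse, even up to [1/2]. *)
Lemma not_quasi_inverse x : 1 / 2 < p (h ** h - (x - x ** (h ** h))).
Proof.
rewrite ltNge; apply/negP => small.
set c := h ** h in small.
set u := c - (x - x ** c) in small.
(* In [z = v + x ** v + u ** z] the telescoped [v] has seminorm at most [2], and the last term is
   absorbed as at most half of [p z]; the resulting bound on [p z] does not depend on [N]. *)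
have bound N : 2 ^+ N <= 4 * (1 + p x) :> R.
  apply: le_trans (p_geo N 0) _.
  set z := geo N 0.
  have cz : c ** z = geo N 2 by rewrite -sa_mulA !h_geo.
  set v := z - c ** z.
  have pv : p v <= 2.
    rewrite /v cz geo_telescope; apply: le_trans (snB _ _) _.
    by rewrite !p_pw.
  have dec : z = v + x ** v + u ** z.
    rewrite /u sa_mulBl sa_mulBl -sa_mulA -sa_mulBr -/v -addrA.
    by rewrite [x ** v + _]addrCA subrr addr0 /v subrK.
  have h1 : p z <= p v + p x * p v + p u * p z.
    rewrite {1}dec; apply: le_trans (snD _ _) _; apply: lerD (snM _ _).
    by apply: le_trans (snD _ _) _; rewrite lerD2l snM.
  by have := sn_ge0 z; have := sn_ge0 x; have := sn_ge0 v; nra.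
have x0 : 0 <= 4 * (1 + p x) by have := sn_ge0 x; lra.
have := archi_boundP x0; rewrite ltNge => /negP; apply.
apply: le_trans (bound (Num.bound (4 * (1 + p x)))).
by rewrite -natrX ler_nat ltnW // ltn_expl.
Qed.

End Approx.
End Seminorm.
End StarAlgebra.

(** * Maxima of finitely many seminorms, and closures *)

Lemma cabs_ge0 (R : realType) (a : R[i]) : 0 <= cabs a.
Proof. by case: a => x y; exact: sqrtr_ge0. Qed.

Lemma Cstar_seminorm_max (R : realType) (A : lmodType R[i]) mul star
    (p q : A -> R) :
  is_Cstar_seminorm mul star p -> is_Cstar_seminorm mul star q ->
  is_Cstar_seminorm mul star (fun x => Num.max (p x) (q x)).
Proof.
move=> Cp Cq; split=> [x y|a x|x y|x].
- rewrite ge_max; apply/andP; split.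
    by apply: le_trans (snD Cp _ _) _; apply: lerD; rewrite le_max lexx.
  by apply: le_trans (snD Cq _ _) _; apply: lerD; rewrite le_max lexx orbT.
- by rewrite (snZ Cp) (snZ Cq) maxr_pMr // cabs_ge0.
- rewrite ge_max; apply/andP; split.
    apply: le_trans (snM Cp _ _) _.
    by apply: ler_pM; rewrite ?(sn_ge0 Cp) // le_max lexx.
  apply: le_trans (snM Cq _ _) _.
  by apply: ler_pM; rewrite ?(sn_ge0 Cq) // le_max lexx orbT.
- rewrite (sn_star_mul Cp) (sn_star_mul Cq).
  have [pq|qp] := leP (p x) (q x).
    by apply/max_idPr; rewrite lerXn2r // nnegrE ?(sn_ge0 Cp) ?(sn_ge0 Cq).
  by apply/max_idPl; rewrite lerXn2r ?(ltW qp) // nnegrE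
    ?(sn_ge0 Cp) ?(sn_ge0 Cq).
Qed.

Lemma lt_eps_eq0 (R : realType) (t : R) :
  0 <= t -> (forall e, 0 < e -> t < e) -> t = 0.
Proof.
move=> t0 lt_e; apply/eqP; rewrite eq_le t0 andbT leNgt; apply/negP => tp.
by have := lt_e _ tp; rewrite ltxx.
Qed.

Section Family.
Variables (R : realType) (A : lmodType R[i]).
Variables (J : Type) (p : J -> A -> R).

(** Each finite list of seminorms is traded for a single one. With base value [0] the kernel of the
    empty list is the whole algebra, where the layer decomposition starts. *)
Fixpoint sup_sn (l : seq J) (x : A) : R :=
  if l is j :: l' then Num.max (p j x) (sup_sn l' x) else 0.

Lemma sup_sn_le l x e :
  0 <= e -> (forall j, List.In j l -> p j x <= e) -> sup_sn l x <= e.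
Proof.
move=> e0; elim: l => [//|j l IH] le_e /=.
by rewrite ge_max le_e /=; [apply: IH => k kl; apply: le_e; right|left].
Qed.

Lemma sup_sn_lt l x e :
  0 < e -> (forall j, List.In j l -> p j x < e) -> sup_sn l x < e.
Proof.
move=> e0; elim: l => [//|j l IH] lt_e /=.
by rewrite gt_max lt_e /=; [apply: IH => k kl; apply: lt_e; right|left].
Qed.

Lemma sup_sn_ge l x j : List.In j l -> p j x <= sup_sn l x.
Proof.
elim: l => [//|k l IH] /= [->|jl]; rewrite le_max ?lexx //.
by rewrite IH ?orbT.
Qed.

Lemma sup_sn_ge0 l x : 0 <= sup_sn l x.
Proof. by elim: l => [//|j l IH] /=; rewrite le_max IH orbT. Qed.

Lemma sup_sn_sub l l' x : List.incl l l' -> sup_sn l x <= sup_sn l' x.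
Proof.
by move=> ll'; apply: sup_sn_le => [|j /ll'];
  [exact: sup_sn_ge0|exact: sup_sn_ge].
Qed.

Lemma sup_sn_Cstar mul star l :
  (forall j, is_Cstar_seminorm mul star (p j)) ->
  is_Cstar_seminorm mul star (sup_sn l).
Proof.
move=> Cp; elim: l => [|j l IH]; last exact: Cstar_seminorm_max.
by split=> *; rewrite /= ?addr0 ?mulr0 ?expr0n.
Qed.

(** This is the closure of [S]; lists are needed because the family [p] is not assumed directed. *)
Definition adherent (S : A -> Prop) (a : A) : Prop :=
  forall l e, 0 < e -> exists s, S s /\ sup_sn l (s - a) < e.

Lemma sn_closedP S : sn_closed p S <-> forall a, adherent S a -> S a.
Proof.
split=> [oS a adh|cl x nSx].
  apply: contrapT => /oS [l [e [e0 nS]]].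
  have [s [Ss lt_e]] := adh l e e0.
  apply: nS Ss => j jl; exact: le_lt_trans (sup_sn_ge _ jl) lt_e.
apply: contrapT => none; apply/nSx/cl => l e e0.
apply: contrapT => noS; apply: none; exists l, e; split=> // y near Sy.
by apply: noS; exists y; split=> //; exact: sup_sn_lt.
Qed.

Lemma sn_converges_sup F a l e : is_proper_filter F -> sn_converges p F a ->
  0 < e -> F (fun y => sup_sn l (y - a) < e).
Proof.
move=> [FT FI FS _] cvg e0; elim: l => [|j l IH] /=.
  by apply: FS FT => y _.
apply: FS (FI _ _ (cvg j e e0) IH) => y [h1 h2].
by rewrite gt_max h1 h2.
Qed.

End Family.

(** * Closed *-ideals and their annihilators *)

Section Annihilator.
Variables (R : realType) (A : lmodType R[i]).
Variables (mul : A -> A -> A) (star : A -> A) (J : Type) (p : J -> A -> R).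
Local Notation "x ** y" := (mul x y) (at level 40, left associativity).
Hypothesis loc_Cstar : is_locally_Cstar mul star p.

Let star_alg : is_star_algebra mul star. Proof. by case: loc_Cstar. Qed.
Let Cp j : is_Cstar_seminorm mul star (p j). Proof. by case: loc_Cstar. Qed.
Let Csup l := sup_sn_Cstar l Cp.

Lemma star_mul_eq0 x : star x ** x = 0 -> x = 0.
Proof.
move=> xx0; case: loc_Cstar => _ _ haus _; apply: haus => j.
apply/eqP; rewrite -sqrf_eq0 -(sn_star_mul (Cp j)) xx0.
by rewrite (sn0 (Cp j)).
Qed.

Lemma locally_Cstar_op : is_locally_Cstar (fun x y => mul y x) star p.
Proof.
case: loc_Cstar => _ _ haus compl; split=> //; first exact: star_algebra_op.
by move=> j; exact: Cstar_seminorm_op.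
Qed.

(** Left ideals stable under [star] are two-sided, see [idealMr]. Closedness is put in terms of
    adherent points, the form in which limits are used. *)
Definition star_ideal (S : A -> Prop) : Prop :=
  [/\ is_left_ideal mul S, (forall x, S x -> S (star x)) &
      (forall a, adherent p S a -> S a)].

Section StarIdeal.
Variable S : A -> Prop.
Hypothesis idS : star_ideal S.

Lemma ideal0 : S 0.
Proof. by case: idS => [[[]]]. Qed.

Lemma idealD x y : S x -> S y -> S (x + y).
Proof. by case: idS => [[[_ h _] _] _ _]; exact: h. Qed.

Lemma idealZ a x : S x -> S (a *: x).
Proof. by case: idS => [[[_ _ h] _] _ _]; exact: h. Qed.

Lemma idealB x y : S x -> S y -> S (x - y).
Proof. by move=> Sx Sy; rewrite -scaleN1r; apply/idealD/idealZ. Qed.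

Lemma ideal_star x : S x -> S (star x).
Proof. by case: idS => _ h _; exact: h. Qed.

Lemma idealMl a x : S x -> S (a ** x).
Proof. by case: idS => [[_ h] _ _]; exact: h. Qed.

Lemma idealMr a x : S x -> S (x ** a).
Proof.
move=> /ideal_star /(idealMl (star a)) /ideal_star.
by rewrite (sa_starM star_alg) !(sa_starK star_alg).
Qed.

(** For [s] in [S], [star (x ** s)] is again in [S], so its product with [x] vanishes and
    [star (x ** s) ** (x ** s) = 0]. *)
Lemma ran_lan x : ran mul S x -> lan mul S x.
Proof.
move=> rx s Ss; apply: star_mul_eq0.
rewrite (sa_mulA star_alg) rx ?(sa_mul0l star_alg) //.
exact/ideal_star/idealMl.
Qed.

Lemma ideal_ran0 x : S x -> ran mul S x -> x = 0.
Proof. by move=> Sx rx; apply/star_mul_eq0/rx/ideal_star. Qed.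

Lemma star_ideal_ran : star_ideal (ran mul S).
Proof.
split=> [|x rx s Ss|a adh s Ss].
- split; first split.
  + by move=> s _; exact: (sa_mul0r star_alg _).
  + by move=> x y rx ry s Ss; rewrite (sa_mulDr star_alg) rx // ry // addr0.
  + by move=> a x rx s Ss; rewrite (sa_mulZr star_alg) rx // scaler0.
  + by move=> a x rx s Ss; rewrite (sa_mulA star_alg) rx //; exact: idealMr.
- rewrite -(sa_starK star_alg (s ** star x)) (sa_starM star_alg).
  rewrite (sa_starK star_alg) (ran_lan rx) ?(sa_star0 star_alg) //.
  exact: ideal_star.
- case: loc_Cstar => _ _ haus _; apply: haus => j.
  apply: lt_eps_eq0 => [|e e0]; first exact: sn_ge0.
  have d0 : 0 < 1 + p j s by have := sn_ge0 (Cp j) s; lra.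
  have [x [rx /=]] := adh [:: j] _ (divr_gt0 e0 d0).
  rewrite gt_max => /andP[near _].
  have -> : s ** a = s ** (a - x) by rewrite (sa_mulBr star_alg) rx // subr0.
  apply: le_lt_trans (snM (Cp j) _ _) _; rewrite (sn_distC (Cp j)).
  move: near; rewrite ltr_pdivlMr //.
  by have := sn_ge0 (Cp j) (x - a); nra.
Qed.

End StarIdeal.

Lemma star_ideal_ker l : star_ideal (fun x => sup_sn p l x = 0).
Proof.
have C := Csup l.
split=> [|x x0|a adh].
- split; first split.
  + exact: (sn0 C).
  + move=> x y x0 y0; apply/eqP; rewrite eq_le (sn_ge0 C) andbT.
    by apply: le_trans (snD C _ _) _; rewrite x0 y0 addr0.
  + by move=> a x x0; rewrite (snZ C) x0 mulr0.
  + move=> a x x0; apply/eqP; rewrite eq_le (sn_ge0 C) andbT.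
    by apply: le_trans (snM C _ _) _; rewrite x0 mulr0.
- by rewrite (sn_star star_alg C).
- apply: lt_eps_eq0 => [|e e0]; first exact: (sn_ge0 C _).
  have [s [s0 lt_e]] := adh l e e0.
  rewrite -(subrK s a); apply: le_lt_trans (snD C _ _) _.
  by rewrite s0 addr0 (sn_distC C).
Qed.

Lemma star_idealI S T : star_ideal S -> star_ideal T ->
  star_ideal (fun x => S x /\ T x).
Proof.
move=> iS iT; split=> [|x [Sx Tx]|a adh].
- split; first split.
  + by split; exact: ideal0.
  + by move=> x y [? ?] [? ?]; split; exact: idealD.
  + by move=> a x [? ?]; split; exact: idealZ.
  + by move=> a x [? ?]; split; exact: idealMl.
- by split; exact: ideal_star.
- case: iS iT => [_ _ clS] [_ _ clT]; split; [apply: clS|apply: clT] => l e e0.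
    by have [s [[Ss _] near]] := adh l e e0; exists s.
  by have [s [[_ Ts] near]] := adh l e e0; exists s.
Qed.

(** For the opposite product this becomes the right-ideal half of [annihilator_algebra]. *)
Definition left_annihilator : Prop := forall K,
  is_left_ideal mul K -> sn_closed p K ->
  (is_zero_set (ran mul K) <-> is_whole K).

Hypothesis ann : left_annihilator.

(** * Density, direct summands and domination from the annihilator condition *)

Lemma adherent_closed S a : adherent p (adherent p S) a -> adherent p S a.
Proof.
move=> adh l e e0; have e2 : 0 < e / 2 by lra.
have [b [adhb near]] := adh l _ e2.
have [s [Ss near']] := adhb l _ e2.
exists s; split=> //; rewrite -(subrKA b).
by apply: le_lt_trans (snD (Csup l) _ _) _; lra.
Qed.

Lemma left_ideal_adherent S : is_left_ideal mul S ->
  is_left_ideal mul (adherent p S).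
Proof.
move=> [[S0 SD SZ] SM]; split; first split.
- by move=> l e e0; exists 0; rewrite subrr (sn0 (Csup l)).
- move=> x y ax ay l e e0; have e2 : 0 < e / 2 by lra.
  have [s [Ss ns]] := ax l _ e2; have [t [St nt]] := ay l _ e2.
  exists (s + t); split; first exact: SD.
  by rewrite opprD addrACA; apply: le_lt_trans (snD (Csup l) _ _) _; lra.
- move=> a x ax l e e0.
  have a0 : 0 <= cabs a by exact: cabs_ge0.
  have d0 : 0 < 1 + cabs a by lra.
  have [s [Ss]] := ax l _ (divr_gt0 e0 d0).
  rewrite ltr_pdivlMr // => near; exists (a *: s); split; first exact: SZ.
  by rewrite -scalerBr (snZ (Csup l)); have := sn_ge0 (Csup l) (s - x); nra.
- move=> a x ax l e e0.
  have a0 := sn_ge0 (Csup l) a.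
  have d0 : 0 < 1 + sup_sn p l a by lra.
  have [s [Ss]] := ax l _ (divr_gt0 e0 d0).
  rewrite ltr_pdivlMr // => near; exists (a ** s); split; first exact: SM.
  rewrite -(sa_mulBr star_alg); apply: le_lt_trans (snM (Csup l) _ _) _.
  by have := sn_ge0 (Csup l) (s - x); nra.
Qed.

(** The annihilator condition applies to the closure of [S], a closed left ideal whose right
    annihilator is contained in that of [S]. *)
Lemma ran0_dense S : is_left_ideal mul S -> (forall x, ran mul S x -> x = 0) ->
  forall a, adherent p S a.
Proof.
move=> iS ran0.
have [whole _] := ann (left_ideal_adherent iS)
  (proj2 (sn_closedP _ _) (@adherent_closed S)).
apply: whole => x; split=> [rx|-> s _]; last exact: (sa_mul0r star_alg _).
apply: ran0 => s Ss; apply: rx => l e e0.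
by exists s; rewrite subrr (sn0 (Csup l)).
Qed.

(* [S + ran S] has zero right annihilator, so it is dense; as both summands
   are dominated by their sum, it is also complete. *)
Lemma star_ideal_summand S : star_ideal S ->
  forall x, exists s, S s /\ ran mul S (x - s).
Proof.
move=> iS x; pose T := ran mul S.
have iT : star_ideal T := star_ideal_ran iS.
pose U a := exists s, S s /\ T (a - s).
have iU : is_left_ideal mul U.
  split; first split.
  - by exists 0; rewrite subrr; split; [exact: (ideal0 iS)|exact: (ideal0 iT)].
  - move=> a b [s [Ss Ts]] [t [St Tt]]; exists (s + t).
    rewrite opprD addrACA; split; first exact: (idealD iS Ss St).
    exact: (idealD iT Ts Tt).
  - move=> a b [s [Ss Ts]]; exists (a *: s).
    rewrite -scalerBr; split; first exact: (idealZ iS _ Ss).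
    exact: (idealZ iT _ Ts).
  - move=> a b [s [Ss Ts]]; exists (a ** s).
    rewrite -(sa_mulBr star_alg); split; first exact: (idealMl iS _ Ss).
    exact: (idealMl iT _ Ts).
have dense : forall a, adherent p U a.
  apply: ran0_dense => // a ra; apply: (ideal_ran0 iT).
    move=> s Ss; apply: ra; exists s; rewrite subrr; split=> //.
    exact: (ideal0 iT).
  move=> t Tt; apply: ra; exists 0; rewrite subr0; split=> //.
  exact: (ideal0 iS).
have dom j s t : S s -> T t -> p j s <= p j (s + t).
  move=> Ss Tt; apply: (sn_orthogonal star_alg (Cp j)).
  by apply: Tt; exact: (ideal_star iS Ss).
(* [F] is generated by the sets of first components [s] of the sums [s + t] close to [x]; [dom]
   makes it Cauchy, and its limit is the component of [x] in [S]. *)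
pose F V := exists l e, 0 < e /\
  forall s t, S s -> T t -> sup_sn p l (s + t - x) < e -> V s.
have pF : is_proper_filter F.
  split.
  - by exists [::], 1.
  - move=> V W [l [e [e0 lV]]] [l' [e' [e0' lW]]].
    exists (l ++ l'), (Num.min e e'); split; first by rewrite lt_min e0.
    move=> s t Ss Tt; rewrite lt_min => /andP[h h']; split.
      apply: lV Ss Tt (le_lt_trans _ h); apply: sup_sn_sub => j jl.
      by apply/List.in_app_iff; left.
    apply: lW Ss Tt (le_lt_trans _ h'); apply: sup_sn_sub => j jl.
    by apply/List.in_app_iff; right.
  - move=> V W VW [l [e [e0 lV]]]; exists l, e; split=> // s t Ss Tt near.
    exact/VW/(lV s t).
  - move=> [l [e [e0 lV]]]; have [a [[s [Ss Ts]] near]] := dense x l e e0.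
    by apply: (lV s (a - s)) => //; rewrite [s + _]addrC subrK.
have [m cvg] : exists m, sn_converges p F m.
  case: loc_Cstar => _ _ _; apply=> // j e e0.
  exists (fun s => S s /\ exists2 t, T t & p j (s + t - x) < e / 2); split.
    exists [:: j], (e / 2); split; first lra.
    move=> s t Ss Tt /=; rewrite gt_max => /andP[near _].
    by split=> //; exists t.
  move=> s s' [Ss [t Tt near]] [Ss' [t' Tt' near']].
  apply: le_lt_trans (dom j _ _ (idealB iS Ss Ss') (idealB iT Tt Tt')) _.
  have -> : s - s' + (t - t') = (s + t - x) - (s' + t' - x).
    by rewrite addrACA -opprD opprB [RHS]addrA subrK.
  by apply: le_lt_trans (snB (Cp j) _ _) _; lra.
have FS V : (forall s, S s -> V s) -> F V.
  by move=> SV; exists [::], 1; split=> // s t Ss _ _; exact: SV.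
exists m; split.
  case: (iS) => _ _; apply=> l e e0.
  have [_ FI _ F0] := pF.
  apply: contrapT => none; apply: F0.
  have [_ _ Fmono _] := pF; apply: Fmono (FI _ _ (FS S (fun _ => id))
    (sn_converges_sup l pF cvg e0)) => s [Ss near].
  by apply: none; exists s.
case: (iT) => _ _; apply=> l e e0; have e2 : 0 < e / 2 by lra.
have [l' [e' [e0' near]]] := sn_converges_sup l pF cvg e2.
have d0 : 0 < Num.min e' (e / 2) by rewrite lt_min e0'.
(* Both lists are needed: closeness for [l'] forces [s] near [m], closeness for [l] controls
   [a - x], and [a - s] must approach [x - m]. *)
have [a [[s [Ss Ts]] near_a]] := dense x (l' ++ l) _ d0.
move: near_a; rewrite lt_min => /andP[a1 a2].
exists (a - s); split=> //.
have n1 : sup_sn p l (s - m) < e / 2.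
  apply: (near s (a - s)) => //; rewrite [s + _]addrC subrK.
  apply: le_lt_trans a1; apply: sup_sn_sub => j jl.
  by apply/List.in_app_iff; left.
have n2 : sup_sn p l (a - x) < e / 2.
  apply: le_lt_trans a2; apply: sup_sn_sub => j jl.
  by apply/List.in_app_iff; right.
have -> : a - s - (x - m) = (a - x) - (s - m).
  by rewrite !opprB addrACA [RHS]addrACA; congr (_ + _); rewrite addrC.
by apply: le_lt_trans (snB (Csup l) _ _) _; lra.
Qed.

(* If [p j h] exceeded the seminorm [q h] of a self-adjoint [h] orthogonal to
   [ker q], rescale to [q h < 1 = p j h].  Any [b] annihilated by all
   [x - x h^2] satisfies [b = h^2 b], so [q b = 0], hence [b = 0]; thus the
   [x - x h^2] are dense, contradicting [not_quasi_inverse]. *)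
Lemma ran_ker_dominated_sa l j h : star h = h ->
  ran mul (fun x => sup_sn p l x = 0) h -> p j h <= sup_sn p l h.
Proof.
have C := Csup l; have iN := star_ideal_ker l.
have iM := star_ideal_ran iN.
move=> sh Mh; rewrite leNgt; apply/negP => lt_h.
have ph0 : 0 < p j h by apply: le_lt_trans lt_h; exact: (sn_ge0 C _).
have ti : 0 <= (p j h)^-1 by rewrite invr_ge0 ltW.
pose g := ((p j h)^-1)%:C%C *: h.
have sg : star g = g by rewrite (sa_starZ star_alg) sh /= oppr0.
have pg : p j g = 1 by rewrite (snZr (Cp j)) // mulVf // gt_eqF.
have qg : sup_sn p l g < 1.
  by rewrite (snZr C) // mulrC ltr_pdivrMr // mul1r.
have Mg : ran mul (fun x => sup_sn p l x = 0) g by exact: (idealZ iM _ Mh).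
pose c := g ** g.
have Mc : ran mul (fun x => sup_sn p l x = 0) c by exact: (idealMl iM _ Mg).
have qc : sup_sn p l c < 1.
  by rewrite (sn_sqr C) // expr_lt1 // (sn_ge0 C).
pose K a := exists x, a = x - x ** c.
have iK : is_left_ideal mul K.
  split; first split.
  - by exists 0; rewrite (sa_mul0l star_alg) subr0.
  - move=> _ _ [x ->] [y ->]; exists (x + y).
    by rewrite (sa_mulDl star_alg) opprD addrACA.
  - by move=> a _ [x ->]; exists (a *: x); rewrite (sa_mulZl star_alg) scalerBr.
  - move=> a _ [x ->]; exists (a ** x).
    by rewrite (sa_mulBr star_alg) (sa_mulA star_alg).
have ran0 b : ran mul K b -> b = 0.
  (* Without a unit, [c ** b = b] cannot be read off directly; testing [rb] on [x = star d] gives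
     [star d ** d = 0]. *)
  move=> rb; have cb : c ** b = b.
    apply/esym/subr0_eq/star_mul_eq0; set d := b - c ** b.
    have := rb (star d - star d ** c) (ex_intro _ _ erefl).
    by rewrite (sa_mulBl star_alg) -(sa_mulA star_alg) -(sa_mulBr star_alg).
  have qb : sup_sn p l b = 0.
    have := snM C c b; rewrite cb; have := sn_ge0 C b; nra.
  by rewrite -cb (ran_lan iN Mc).
have half : 0 < 1 / 2 :> R by lra.
have [_ [[x ->] near]] := ran0_dense iK ran0 c [:: j] half.
move: near; rewrite /= gt_max (sn_distC (Cp j)) => /andP[near _].
by have := not_quasi_inverse star_alg (Cp j) sg pg x; rewrite -/c ltNge ltW.
Qed.

(** The self-adjoint case applies to [star x ** x], and the C*-identity permits taking square
    roots. *)
Lemma ran_ker_dominated l j x :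
  ran mul (fun x => sup_sn p l x = 0) x -> p j x <= sup_sn p l x.
Proof.
have C := Csup l; move=> Mx.
have : p j (star x ** x) <= sup_sn p l (star x ** x).
  apply: ran_ker_dominated_sa.
    by rewrite (sa_starM star_alg) (sa_starK star_alg).
  exact: (idealMl (star_ideal_ran (star_ideal_ker l)) _ Mx).
by rewrite (sn_star_mul (Cp j)) (sn_star_mul C) ler_pXn2r // nnegrE;
  [exact: (sn_ge0 (Cp j) _)|exact: (sn_ge0 C _)].
Qed.

(** * The projection onto a closed *-ideal *)

Section Projection.
Variable S : A -> Prop.
Hypothesis idS : star_ideal S.

Definition ideal_proj x : A := sval (cid (star_ideal_summand idS x)).

Lemma ideal_proj_in x : S (ideal_proj x).
Proof. by rewrite /ideal_proj; case: cid => s []. Qed.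

Lemma ideal_proj_ran x : ran mul S (x - ideal_proj x).
Proof. by rewrite /ideal_proj; case: cid => s []. Qed.

(** The difference of two candidates lies in both [S] and [ran mul S], which meet only in zero. The
    algebraic laws of the projection follow from this uniqueness. *)
Lemma ideal_proj_uniq x s : S s -> ran mul S (x - s) -> ideal_proj x = s.
Proof.
move=> Ss rs; apply/subr0_eq/(ideal_ran0 idS).
  exact: (idealB idS (ideal_proj_in x) Ss).
have -> : ideal_proj x - s = (x - s) - (x - ideal_proj x).
  by rewrite opprB [RHS]addrC addrA subrK.
exact: (idealB (star_ideal_ran idS) rs (ideal_proj_ran x)).
Qed.

Lemma ideal_proj_id x : S x -> ideal_proj x = x.
Proof.
move=> Sx; apply: ideal_proj_uniq => //; rewrite subrr.
exact: (ideal0 (star_ideal_ran idS)).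
Qed.

Lemma ideal_projD x y : ideal_proj (x + y) = ideal_proj x + ideal_proj y.
Proof.
apply: ideal_proj_uniq.
  exact: (idealD idS (ideal_proj_in x) (ideal_proj_in y)).
rewrite opprD addrACA.
exact: (idealD (star_ideal_ran idS) (ideal_proj_ran x) (ideal_proj_ran y)).
Qed.

Lemma ideal_projZ a x : ideal_proj (a *: x) = a *: ideal_proj x.
Proof.
apply: ideal_proj_uniq; first exact: (idealZ idS _ (ideal_proj_in x)).
rewrite -scalerBr.
exact: (idealZ (star_ideal_ran idS) _ (ideal_proj_ran x)).
Qed.

Lemma ideal_proj_star x : ideal_proj (star x) = star (ideal_proj x).
Proof.
apply: ideal_proj_uniq; first exact: (ideal_star idS (ideal_proj_in x)).
rewrite -(sa_starB star_alg).
exact: (ideal_star (star_ideal_ran idS) (ideal_proj_ran x)).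
Qed.

Lemma ideal_projM x y : ideal_proj (x ** y) = ideal_proj x ** ideal_proj y.
Proof.
have iT := star_ideal_ran idS.
apply: ideal_proj_uniq; first exact: (idealMl idS _ (ideal_proj_in y)).
have -> : x ** y - ideal_proj x ** ideal_proj y =
    (x - ideal_proj x) ** y + ideal_proj x ** (y - ideal_proj y).
  by rewrite (sa_mulBl star_alg) (sa_mulBr star_alg) addrA subrK.
apply: (idealD iT); first exact: (idealMr iT _ (ideal_proj_ran x)).
exact: (idealMl iT _ (ideal_proj_ran y)).
Qed.

Lemma ideal_proj_le l x : sup_sn p l (ideal_proj x) <= sup_sn p l x.
Proof.
rewrite -{2}(subrK (ideal_proj x) x) addrC.
apply: (sn_orthogonal star_alg (Csup l)); apply: ideal_proj_ran.
exact: (ideal_star idS (ideal_proj_in x)).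
Qed.

End Projection.
End Annihilator.

(** The preimage [L] of a closed left ideal [K] is a closed left ideal, and its right annihilator is
    zero when that of [K] is; so [L] is everything, and surjectivity gives the same for [K]. *)
Lemma left_annihilator_image (R : realType) (A T : lmodType R[i])
    mulA starA (J : Type) (p : J -> A -> R)
    mulT starT (JT : Type) (pT : JT -> T -> R) (f : A -> T) :
  is_locally_Cstar mulA starA p -> is_locally_Cstar mulT starT pT ->
  {morph f : x y / x + y} -> (forall a, {morph f : x / a *: x}) ->
  (forall x y, f (mulA x y) = mulT (f x) (f y)) ->
  (forall x, f (starA x) = starT (f x)) ->
  (forall t, exists x, f x = t) ->
  (forall l, exists l', forall x, sup_sn pT l (f x) <= sup_sn p l' x) ->
  left_annihilator mulA p -> left_annihilator mulT pT.
Proof.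
move=> lA lT fD fZ fM fs fsurj fcont ann K [[K0 KD KZ] KM] clK.
have [sA _ _ _] := lA; have [sT _ _ _] := lT.
have f0 : f 0 = 0 by rewrite -(scale0r 0) fZ !scale0r.
have fB x y : f (x - y) = f x - f y.
  by rewrite -scaleN1r fD fZ scaleN1r.
split=> [ranK|whole x]; last first.
  split=> [rx|-> s _]; last exact: (sa_mul0r sT).
  exact/(star_mul_eq0 lT)/rx/whole.
pose L x := K (f x).
have iL : is_left_ideal mulA L.
  split; first split; rewrite /L.
  - by rewrite f0.
  - by move=> x y Kx Ky; rewrite fD; exact: KD.
  - by move=> a x Kx; rewrite fZ; exact: KZ.
  - by move=> a x Kx; rewrite fM; exact: KM.
have clL : sn_closed p L.
  apply/sn_closedP => a adh; apply: (proj1 (sn_closedP _ _) clK) => l e e0.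
  have [l' cont] := fcont l; have [s [Ls near]] := adh l' e e0.
  by exists (f s); rewrite -fB; split=> //; exact: le_lt_trans near.
(* By surjectivity [f x] annihilates [K], so [f x = 0]; hence [star x] belongs to [L] and [star x]
   times [x] is zero. *)
have ran0 x : ran mulA L x -> x = 0.
  move=> rx; apply: (star_mul_eq0 lA); apply: (rx); rewrite /L fs.
  have /ranK -> : ran mulT K (f x).
    move=> s Ks; have [y fy] := fsurj s.
    by rewrite -fy -fM rx ?f0 // /L fy.
  by rewrite (sa_star0 sT).
have [whole _] := ann L iL clL.
move=> t; have [x <-] := fsurj t; apply: whole => {t}x.
by split=> [/ran0 //|->]; move=> s _; exact: (sa_mul0r sA).
Qed.

(** * A subspace as a module of its own *)

Section Subspace.
Variables (R : realType) (A : lmodType R[i]) (S : A -> Prop).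
Hypothesis subS : is_subspace S.

(** The proof is an argument so that the closure instance below can be found from the predicate
    alone. *)
Definition subspace_pred of is_subspace S : {pred A} := fun x => `[<S x>].

Lemma subspace_submod_closed : submod_closed (subspace_pred subS).
Proof.
case: subS => S0 SD SZ.
split=> [|a x y /asboolP Sx /asboolP Sy]; apply/asboolP => //.
exact/SD/Sy/SZ.
Qed.

HB.instance Definition _ := GRing.isSubmodClosed.Build R[i] A
  (subspace_pred subS) subspace_submod_closed.

Definition subspace_type := {x : A | x \in subspace_pred subS}.
HB.instance Definition _ := SubChoice.on subspace_type.
HB.instance Definition _ := [SubChoice_isSubLmodule of subspace_type by <:].

Definition to_subspace (x : A) : subspace_type := insubd 0 x.

Lemma to_subspaceK x : S x -> val (to_subspace x) = x.
Proof. by move=> Sx; rewrite val_insubd ifT //; exact/asboolP. Qed.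

Lemma subspaceP (t : subspace_type) : S (val t).
Proof. exact/asboolP/(valP t). Qed.

End Subspace.

(** * Closed *-ideals on which one seminorm dominates, as C*-algebras *)

Section Block.
Variables (R : realType) (A : lmodType R[i]).
Variables (mul : A -> A -> A) (star : A -> A) (J : Type) (p : J -> A -> R).
Hypothesis loc_Cstar : is_locally_Cstar mul star p.
Variables (S : A -> Prop) (l : seq J).
Hypothesis idS : star_ideal mul star p S.
Hypothesis dom : forall j x, S x -> p j x <= sup_sn p l x.

Let star_alg : is_star_algebra mul star. Proof. by case: loc_Cstar. Qed.
Let Cp j : is_Cstar_seminorm mul star (p j). Proof. by case: loc_Cstar. Qed.
Let Csup := sup_sn_Cstar l Cp.

Lemma star_ideal_subspace : is_subspace S.
Proof. by case: idS => [[]]. Qed.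

Let T : lmodType R[i] := subspace_type star_ideal_subspace.
Let in_T : A -> T := to_subspace star_ideal_subspace.

Definition block_mul (s t : T) : T := in_T (mul (val s) (val t)).
Definition block_star (s : T) : T := in_T (star (val s)).
Definition block_norm (s : T) : R := sup_sn p l (val s).

Let val_in_T x : S x -> val (in_T x) = x.
Proof. exact: to_subspaceK. Qed.

Let val_T (t : T) : S (val t).
Proof. exact: subspaceP. Qed.

Lemma val_block_mul s t : val (block_mul s t) = mul (val s) (val t).
Proof. by rewrite val_in_T //; exact: (idealMl idS _ (val_T t)). Qed.

Lemma val_block_star s : val (block_star s) = star (val s).
Proof. by rewrite val_in_T //; exact: (ideal_star idS (val_T s)). Qed.

(** By [dom], the norm separates points of [S], and a filter that is Cauchy for it is Cauchy for
    every [p j]; the limit in the ambient algebra stays in the closed set [S]. *)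
Lemma block_locally_Cstar :
  is_locally_Cstar block_mul block_star (fun _ : unit => block_norm).
Proof.
have vD (s t : T) : val (s + t) = val s + val t by exact: raddfD.
have vB (s t : T) : val (s - t) = val s - val t by exact: raddfB.
have vZ a (s : T) : val (a *: s) = a *: val s by exact: linearZ.
have vM := val_block_mul; have vS := val_block_star.
split.
- do !split => *; apply: val_inj; rewrite ?(vM, vS, vD, vZ) //=.
  + exact: (sa_mulA star_alg).
  + exact: (sa_mulDl star_alg).
  + exact: (sa_mulDr star_alg).
  + exact: (sa_mulZl star_alg).
  + exact: (sa_mulZr star_alg).
  + exact: (sa_starD star_alg).
  + exact: (sa_starZ star_alg).
  + exact: (sa_starK star_alg).
  + exact: (sa_starM star_alg).
- move=> _; rewrite /block_norm; split=> [s t|a s|s t|s].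
  + by rewrite vD; exact: (snD Csup).
  + by rewrite vZ; exact: (snZ Csup).
  + by rewrite vM; exact: (snM Csup).
  + by rewrite vM vS; exact: (sn_star_mul Csup).
- move=> s /(_ tt) s0; apply: val_inj; case: loc_Cstar => _ _ + _; apply=> j.
  apply/eqP; rewrite eq_le (sn_ge0 (Cp j)) andbT -s0.
  exact: dom (val_T s).
- move=> F pF cF; have [FT FI FS F0] := pF.
  pose G U := F (fun s => U (val s)).
  have pG : is_proper_filter G.
    split=> //; first by move=> U V; exact: FI.
    by move=> U V UV; apply: FS => s; exact: UV.
  have [a cvg] : exists a, sn_converges p G a.
    case: loc_Cstar => _ _ _; apply=> // j e e0.
    have [V [FV small]] := cF tt e e0.
    exists (fun x => exists2 s, V s & val s = x); split.
      by apply: FS FV => s Vs; exists s.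
    move=> _ _ [s Vs <-] [t Vt <-]; rewrite -vB.
    by apply: le_lt_trans (dom _ (val_T _)) _; exact: small.
  have Sa : S a.
    case: idS => _ _; apply=> k e e0; apply: contrapT => none; apply: F0.
    apply: FS (sn_converges_sup k pG cvg e0) => s near.
    by apply: none; exists (val s).
  exists (in_T a) => _ e e0.
  apply: FS (sn_converges_sup l pG cvg e0) => s.
  by rewrite /block_norm vB val_in_T.
Qed.

Definition block : Cstar_algebra R := CstarAlg block_locally_Cstar.

Hypothesis annL : left_annihilator mul p.
Hypothesis annR : left_annihilator (fun x y => mul y x) p.

Definition block_proj (x : A) : cs_car block :=
  in_T (ideal_proj loc_Cstar annL idS x).

Lemma val_block_proj x :
  val (block_proj x : T) = ideal_proj loc_Cstar annL idS x.
Proof. by rewrite val_in_T //; exact: ideal_proj_in. Qed.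

Lemma block_projD x y : block_proj (x + y) = block_proj x + block_proj y.
Proof.
apply: val_inj; rewrite val_block_proj ideal_projD -!val_block_proj.
by rewrite [RHS]raddfD.
Qed.

Lemma block_projZ a x : block_proj (a *: x) = a *: block_proj x.
Proof.
apply: val_inj; rewrite val_block_proj ideal_projZ -!val_block_proj.
by rewrite [RHS]linearZ.
Qed.

Lemma block_projM x y :
  block_proj (mul x y) = cs_mul (block_proj x) (block_proj y).
Proof.
apply: val_inj; rewrite val_block_proj ideal_projM -!val_block_proj.
by rewrite [RHS]val_block_mul.
Qed.

Lemma block_proj_star x : block_proj (star x) = cs_star (block_proj x).
Proof.
apply: val_inj; rewrite val_block_proj ideal_proj_star -!val_block_proj.
by rewrite [RHS]val_block_star.
Qed.

Lemma block_projK (t : cs_car block) : block_proj (val (t : T)) = t.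
Proof.
by apply: val_inj; rewrite val_block_proj ideal_proj_id //; exact: val_T.
Qed.

Lemma block_proj_le x : cs_norm (block_proj x) <= sup_sn p l x.
Proof.
by rewrite /= /block_norm val_block_proj; exact: ideal_proj_le.
Qed.

(** The projection is a continuous surjective *-homomorphism, for the given products and equally for
    the opposite ones, which handles left and right ideals in turn. *)
Lemma block_annihilator : cs_annihilator block.
Proof.
have surj (t : cs_car block) : exists x, block_proj x = t.
  by exists (val (t : T)); exact: block_projK.
have cont (k : seq unit) : exists k', forall x,
    sup_sn (fun _ => @cs_norm R block) k (block_proj x) <= sup_sn p k' x.
  exists l => x; apply: sup_sn_le => [|_ _]; first exact: sup_sn_ge0.
  exact: block_proj_le.
split.
- exact: (left_annihilator_image loc_Cstar (cs_ax block) block_projD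
    block_projZ block_projM block_proj_star surj cont annL).
- exact: (left_annihilator_image (locally_Cstar_op loc_Cstar)
    (locally_Cstar_op (cs_ax block)) block_projD
    block_projZ (fun x y => block_projM y x) block_proj_star surj cont annR).
Qed.

End Block.

(** The list [L n] controls the metric ball of radius [1 / (n + 1)] at [0]. If its seminorms vanish
    at [x], that ball contains the whole line through [x], so a [p j] below [1] on the ball vanishes
    at [x]. Comparing kernels is enough, as [ran_ker_dominated] later turns this into
    inequalities. *)
Lemma metrizable_countable (R : realType) (A : lmodType R[i]) mul star
    (J : Type) (p : J -> A -> R) :
  (forall j, is_Cstar_seminorm mul star (p j)) -> metrizable p ->
  exists L : nat -> seq J, forall j, exists n, forall x,
    sup_sn p (L n) x = 0 -> p j x = 0.
Proof.
move=> Cp [d [[d0 dC dT] dP]].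
have step n : exists l : seq J, exists2 e : R, 0 < e &
    forall y, sup_sn p l y < e -> d 0 y < n.+1%:R^-1.
  have n0 : 0 < n.+1%:R^-1 :> R by rewrite invr_gt0.
  have oU : sn_open p (fun y => d 0 y < n.+1%:R^-1).
    apply/dP => x dx; exists (n.+1%:R^-1 - d 0 x); split=> [|y dy].
      by rewrite subr_gt0.
    by apply: le_lt_trans (dT _ x _) _; rewrite addrC -ltrBrDr.
  have d00 : d 0 0 < n.+1%:R^-1 by rewrite (proj2 (d0 0 0) erefl).
  have [l [e [e0 near]]] := oU 0 d00.
  exists l, e => // y ly; apply: near => j jl; rewrite subr0.
  exact: le_lt_trans (sup_sn_ge _ _ jl) ly.
have [L LP] := choice step; exists L => j.
have oj : sn_open p (fun y => p j y < 1).
  move=> x px; exists [:: j], (1 - p j x).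
  split=> [|y /(_ j (or_introl erefl)) py].
    by rewrite subr_gt0.
  by rewrite -(subrK x y); apply: le_lt_trans (snD (Cp j) _ _) _; lra.
have p0 : p j 0 < 1 by rewrite (sn0 (Cp j)).
have [e [e0 near]] := (proj1 (dP _) oj) 0 p0.
have ei : 0 <= e^-1 by rewrite invr_ge0 ltW.
(* This index makes the radius [1 / (n + 1)] smaller than [e]. *)
exists (Num.bound e^-1) => x x0; have [r r0 small] := LP (Num.bound e^-1).
have lt1 t : 0 <= t -> t * p j x < 1.
  move=> t0; rewrite -(snZr (Cp j)) //; apply: near.
  apply: lt_trans (small _ _) _.
    by rewrite (snZr (sup_sn_Cstar _ Cp)) // x0 mulr0.
  rewrite invf_plt ?posrE //; apply: lt_le_trans (archi_boundP ei) _.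
  by rewrite ler_nat.
apply/eqP; rewrite eq_le (sn_ge0 (Cp j)) andbT leNgt; apply/negP => px.
have := lt1 (p j x)^-1; rewrite mulVf ?gt_eqF // ltxx => /(_ _)/negP.
by apply=> //; rewrite invr_ge0 ltW.
Qed.

(** * Orthogonal layers and the product decomposition *)

Section Decomposition.
Variables (R : realType) (A : lmodType R[i]).
Variables (mul : A -> A -> A) (star : A -> A) (J : Type) (p : J -> A -> R).
Hypothesis loc_Cstar : is_locally_Cstar mul star p.
Hypothesis annL : left_annihilator mul p.
Hypothesis annR : left_annihilator (fun x y => mul y x) p.
Variable L : nat -> seq J.
Hypothesis LP : forall j, exists n, forall x,
  sup_sn p (L n) x = 0 -> p j x = 0.

Let star_alg : is_star_algebra mul star. Proof. by case: loc_Cstar. Qed.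
Let Cp j : is_Cstar_seminorm mul star (p j). Proof. by case: loc_Cstar. Qed.
Let Csup l := sup_sn_Cstar l Cp.

Fixpoint first_seminorms n : seq J :=
  if n is m.+1 then first_seminorms m ++ L m else [::].
Let G := first_seminorms.

Let N n x := sup_sn p (G n) x = 0.
Let B n x := ran mul (N n.+1) x /\ N n x.

Let iN n : star_ideal mul star p (N n).
Proof. exact: star_ideal_ker. Qed.

Let iM n : star_ideal mul star p (ran mul (N n)).
Proof. exact: (star_ideal_ran loc_Cstar (iN n)). Qed.

Lemma layer_star_ideal n : star_ideal mul star p (B n).
Proof. exact: (star_idealI (iM n.+1) (iN n)). Qed.
Let iB := layer_star_ideal.

Lemma layer_dominated n j x : B n x -> p j x <= sup_sn p (G n.+1) x.
Proof. by move=> [Mx _]; exact: (ran_ker_dominated loc_Cstar annL). Qed.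

Definition layer n := block loc_Cstar (iB n) (@layer_dominated n).
Definition layers x : prodB layer := fun n =>
  block_proj loc_Cstar (iB n) (@layer_dominated n) annL x.

Let P n x := ideal_proj loc_Cstar annL (iB n) x.
Let val_layer n (t : cs_car (layer n)) : A := \val t.

Let val_layers x n : val_layer (layers x n) = P n x.
Proof. exact: val_block_proj. Qed.

Let val_layer_in n (t : cs_car (layer n)) : B n (val_layer t).
Proof. exact: subspaceP. Qed.

Lemma ker_sup_sn_sub l l' x :
  List.incl l l' -> sup_sn p l' x = 0 -> sup_sn p l x = 0.
Proof.
move=> ll' x0; apply/eqP; rewrite eq_le sup_sn_ge0 andbT -x0.
exact: sup_sn_sub.
Qed.

Let N_le m n x : (m <= n)%N -> N n x -> N m x.
Proof.
move=> /subnKC <-; elim: (n - m)%N => [|i IH]; first by rewrite addn0.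
rewrite addnS => Nx; apply: IH; apply: ker_sup_sn_sub Nx.
exact: List.incl_appl (List.incl_refl _).
Qed.

Let p_N j : exists n, forall x, N n x -> p j x = 0.
Proof.
have [n Ln] := LP j; exists n.+1 => x Nx; apply: Ln.
exact: ker_sup_sn_sub (List.incl_appr _ (List.incl_refl _)) Nx.
Qed.

(** Here [B n] lies in [N n], hence in [N m.+1], which is annihilated by [B m]. *)
Lemma layer_orthogonal n m x : (m < n)%N -> B m x -> ran mul (B n) x.
Proof. by move=> mn [Mx _] s [_ Ns]; apply: Mx; exact: N_le Ns. Qed.

Lemma layer_ran_ker n x : N n.+1 x -> ran mul (B n) x.
Proof. by move=> Nx s [Ms _]; exact: (ran_lan loc_Cstar (iN _) Ms). Qed.

Lemma layer_sum_orthogonal n (b : nat -> A) :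
  (forall k, B k (b k)) -> ran mul (B n) (\sum_(k < n) b k).
Proof.
move=> Bb; have iR := star_ideal_ran loc_Cstar (iB n).
elim/big_ind: _ => [|x y rx ry|k _]; first exact: (ideal0 iR).
  exact: (idealD iR rx ry).
exact: layer_orthogonal (ltn_ord k) (Bb k).
Qed.

(** Split the remainder [y] in [N n] along [N n.+1] as [s + (y - s)]. Then [y - s] is in [B n], and
    it is the component of [x] there, because [s] and the earlier components are orthogonal to
    [B n]; the new remainder is [s]. *)
Lemma layer_remainder n x : N n (x - \sum_(k < n) P k x).
Proof.
elim: n => [|n IH]; first by [].
set y := x - _ in IH.
have [s [Ns Ms]] := star_ideal_summand loc_Cstar annL (iN n.+1) y.
have Bt : B n (y - s).
  by split=> //; exact: (idealB (iN n) IH (N_le (leqnSn n) Ns)).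
have Pn : P n x = y - s.
  apply: ideal_proj_uniq => //.
  have -> : x - (y - s) = \sum_(k < n) P k x + s.
    by rewrite /y !opprB addrCA [x + _]addrC subrK addrC.
  apply: (idealD (star_ideal_ran loc_Cstar (iB n))).
    apply: (layer_sum_orthogonal (b := fun k => P k x)) => k.
    exact: ideal_proj_in.
  exact: (layer_ran_ker Ns).
by rewrite big_ord_recr /= Pn opprD addrA -/y opprB addrC subrK.
Qed.

Lemma layers_inj : injective layers.
Proof.
move=> x y exy; apply/subr0_eq.
case: loc_Cstar => _ _ haus _; apply: haus => j.
have [n Nn] := p_N j; apply: Nn.
have -> : x - y = (x - \sum_(k < n) P k x) - (y - \sum_(k < n) P k y).
  have -> : \sum_(k < n) P k x = \sum_(k < n) P k y.
    by apply: eq_bigr => k _; rewrite -!val_layers exy.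
  by rewrite opprB addrA subrK.
exact: (idealB (iN n) (layer_remainder n x) (layer_remainder n y)).
Qed.

(** Modulo [N m] the partial sums [s n] are constant for [n >= m], and each [p j] vanishes on some
    [N m], so they converge to some [x] with [x - s n] in [N n]. *)
Lemma layers_surj y : exists x, layers x = y.
Proof.
pose b k := val_layer (y k).
have Bb k : B k (b k) by exact: val_layer_in.
pose s n := \sum_(k < n) b k.
have sS n : s n.+1 = s n + b n by rewrite /s big_ord_recr.
have Ns m n : (m <= n)%N -> N m (s n - s m).
  move=> /subnKC <-; elim: (n - m)%N => [|i IH].
    by rewrite addn0 subrr; exact: (ideal0 (iN m)).
  rewrite addnS sS addrAC; apply: (idealD (iN m)) => //.
  by have [_ Nb] := Bb (m + i)%N; exact: (N_le (leq_addr _ _) Nb).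
pose F U := exists m, forall n, (m <= n)%N -> U (s n).
have pF : is_proper_filter F.
  split.
  - by exists 0%N.
  - move=> U V [m mU] [n nV]; exists (maxn m n) => k.
    by rewrite geq_max => /andP[mk nk]; split; [exact: mU|exact: nV].
  - by move=> U V UV [m mU]; exists m => n mn; exact/UV/mU.
  - by move=> [m /(_ m (leqnn m))].
have [x cvg] : exists x, sn_converges p F x.
  case: loc_Cstar => _ _ _; apply=> // j e e0; have [m Nm] := p_N j.
  exists (fun z => exists2 n, (m <= n)%N & z = s n); split.
    by exists m => n mn; exists n.
  move=> _ _ [n mn ->] [k mk ->]; rewrite Nm //.
  have -> : s n - s k = (s n - s m) - (s k - s m) by rewrite opprB addrA subrK.
  exact: (idealB (iN m) (Ns _ _ mn) (Ns _ _ mk)).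
have Nx n : N n (x - s n).
  case: (iN n) => _ _; apply=> l e e0.
  have [m near] := sn_converges_sup l pF cvg e0.
  exists (s (maxn m n) - s n); split; first exact: Ns (leq_maxr _ _).
  by rewrite opprB addrA subrK; apply: near; exact: leq_maxl.
exists x; apply: functional_extensionality_dep => n; apply: val_inj.
rewrite [LHS]val_layers; apply: ideal_proj_uniq; first exact: Bb.
(* Both terms are orthogonal to [B n]: the first is a sum over earlier layers, the second lies in
   [N n.+1]. *)
have -> : x - val (y n) = s n + (x - s n.+1).
  by rewrite sS opprD addrCA [s n + (_ + _)]addrA subrr add0r.
apply: (idealD (star_ideal_ran loc_Cstar (iB n))).
  exact: layer_sum_orthogonal.
exact: layer_ran_ker.
Qed.

Lemma layersB x y n : layers (x - y) n = layers x n - layers y n.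
Proof.
by rewrite /layers -scaleN1r block_projD block_projZ scaleN1r.
Qed.

(** Coordinate [i] is a contraction for [sup_sn p (G i.+1)], and basic open sets of the product
    constrain only finitely many coordinates. *)
Lemma layers_continuous U :
  prod_open U -> sn_open p (fun x => U (layers x)).
Proof.
move=> oU x /oU [F [V [FV sub]]].
suff [l [e [e0 near]]] : exists l e, 0 < e /\ forall y,
    (forall j, List.In j l -> p j (y - x) < e) ->
    forall i, List.In i F -> V i (layers y i).
  by exists l, e; split=> // y ly; apply/sub/near.
elim: F FV {sub} => [|i F IH] FV; first by exists [::], 1.
have [|l [e [e0 near]]] := IH; first by move=> k kF; apply: FV; right.
have [oV Vx] := FV i (or_introl erefl).
have [F' [e' [e0' near']]] := oV _ Vx.
exists (G i.+1 ++ l), (Num.min e e'); split; first by rewrite lt_min e0.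
move=> y small k [<-|kF].
  apply: near' => _ _; rewrite -layersB.
  apply: le_lt_trans (block_proj_le _ _ _ _ _) _.
  apply: sup_sn_lt => // j jG.
  have /small : List.In j (G i.+1 ++ l) by apply/List.in_app_iff; left.
  by rewrite lt_min => /andP[].
apply: near => // j jl.
have /small : List.In j (G i.+1 ++ l) by apply/List.in_app_iff; right.
by rewrite lt_min => /andP[].
Qed.

Lemma ker_sup_sn_cofinal l :
  exists n, forall x, N n x -> forall j, List.In j l -> p j x = 0.
Proof.
elim: l => [|j l [n IH]]; first by exists 0%N.
have [m Nm] := p_N j; exists (maxn m n) => x Nx k [<-|].
  by apply: Nm; exact: N_le (leq_maxl _ _) Nx.
by apply: IH; exact: N_le (leq_maxr _ _) Nx.
Qed.

(** A neighbourhood of [x] involves a finite list [l], whose seminorms vanish on some [N n]. Only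
    the components below [n] then matter, and the layer norms bound the seminorms on them. *)
Lemma layers_open V :
  sn_open p V -> prod_open (fun y => exists x, V x /\ layers x = y).
Proof.
move=> oV _ [x [Vx <-]]; have [l [e [e0 near]]] := oV x Vx.
have [n Nn] := ker_sup_sn_cofinal l.
(* Dividing by [n + 1] keeps [n] terms of size at most [d] strictly below [e], and covers
   [n = 0]. *)
pose d := e / n.+1%:R.
have d0 : 0 < d by rewrite divr_gt0.
exists (List.seq 0 n), (fun i t => cs_norm (t - layers x i) < d); split.
  move=> i _; split; last first.
    have [_ /(_ tt) Ci _ _] := cs_ax (layer i).
    by rewrite subrr (sn0 Ci).
  move=> t td; exists [:: tt], (d - cs_norm (t - layers x i)).
  split=> [|u /(_ tt (or_introl erefl)) ut]; first by rewrite subr_gt0.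
  have [_ /(_ tt) Ci _ _] := cs_ax (layer i).
  rewrite -(subrKA t); apply: le_lt_trans (snD Ci _ _) _.
  by rewrite -ltrBrDr.
move=> y ny; have [x' ex'] := layers_surj y.
exists x'; split=> //; apply: near => j jl; set z := x' - x.
have small k : (k < n)%N -> p j (P k z) <= d.
  move=> kn; have lt_d : cs_norm (layers z k) < d.
    by rewrite layersB ex'; apply: ny; apply/List.in_seq; split;
      [exact/ssrnat.leP|exact/ssrnat.ltP].
  apply: le_trans (ltW lt_d); rewrite /= /block_norm [\val _]val_layers.
  exact: (layer_dominated _ (ideal_proj_in _ _ _ _)).
have sum m : (m <= n)%N -> p j (\sum_(k < m) P k z) <= m%:R * d.
  elim: m => [_|m IH mn]; first by rewrite big_ord0 (sn0 (Cp j)) mul0r.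
  rewrite big_ord_recr /= -natr1 mulrDl mul1r.
  by apply: le_trans (snD (Cp j) _ _) _; rewrite lerD ?IH ?small // ltnW.
rewrite -(subrK (\sum_(k < n) P k z) z).
apply: le_lt_trans (snD (Cp j) _ _) _.
rewrite (Nn _ (layer_remainder n z) j jl) add0r.
apply: le_lt_trans (sum n (leqnn n)) _.
by rewrite /d mulrCA gtr_pMr // ltr_pdivrMr // mul1r ltr_nat.
Qed.

Lemma layers_top_star_iso : top_star_iso mul star p layers.
Proof.
split; first by move=> x y i; exact: block_projD.
split; first by move=> a x i; exact: block_projZ.
split; first by move=> x y i; exact: block_projM.
split; first by move=> x i; exact: block_proj_star.
split; last by split; [exact: layers_continuous|exact: layers_open].
have [g gK] := choice layers_surj.
by exists g => // x; apply: layers_inj; rewrite gK.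
Qed.

Lemma layer_annihilator n : cs_annihilator (layer n).
Proof. exact: block_annihilator. Qed.

End Decomposition.

Theorem theorem3p30 (R : realType) (A : lmodType R[i]) (mul : A -> A -> A)
  (star : A -> A) (J : Type) (p : J -> A -> R) :
  is_sigma_Cstar mul star p ->
  annihilator_algebra mul p ->
  exists (I : Type) (B : I -> Cstar_algebra R) (phi : A -> prodB B),
    countable_type I /\
    (forall i, cs_annihilator (B i)) /\
    top_star_iso mul star p phi.
Proof.
move=> [loc_Cstar metr] [annL annR].
have [_ Cp _ _] := loc_Cstar.
have [L LP] := metrizable_countable Cp metr.
exists nat, (layer loc_Cstar annL L), (layers loc_Cstar annL L).
split; first by exists id.
split; first by move=> n; exact: layer_annihilator.
exact: layers_top_star_iso.
Qed.
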